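(* Let $(X,d)$ be a uniformly disconnected metric space. There is a constant $L\ge 1$ such that for any integers $n>m\ge 1$ there exists an $L$-Lipschitz retraction $\mathcal R\colon X(n)\to X(m)$.
   Context: A metric space $(X,d)$ is uniformly disconnected if there exists a constant $c>0$ such that any finite sequence $x_0,\dots,x_n$ in $X$ satisfies $\max_{1\le k\le n}d(x_k,x_{k-1})\ge c\,d(x_0,x_n)$. For a metric space $(X,d)$ and a positive integer $n$, $X(n)=\{A\subset X\colon 1\le |A|\le n\}$, equipped with the Hausdorff metric $\Delta(A,B)=\max\left(\sup_{a\in A}\operatorname{dist}(a,B),\ \sup_{b\in B}\operatorname{dist}(b,A)\right)$; for $m<n$, $X(m)\subset X(n)$. A retraction $\mathcal R\colon X(n)\to X(m)$ is a map whose restriction to $X(m)$ is the identity; it is $L$-Lipschitz if $\Delta(\mathcal R(A),\mathcal R(B))\le L\,\Delta(A,B)$ for all $A,B\in X(n)$. *)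

(* Defs.v *)
From HB Require Import structures.
From mathcomp Require Import all_boot all_order all_algebra.
From mathcomp Require Import all_classical all_reals all_analysis.
Set Implicit Arguments.
Unset Strict Implicit.
Unset Printing Implicit Defensive.
Import Order.TTheory GRing.Theory Num.Theory.
Local Open Scope classical_set_scope.
Local Open Scope card_scope.
Local Open Scope ring_scope.

(* A finite sequence x_0, ..., x_n is given by the first n+1 values of
   x : nat -> X. The default value 0 of the iterated maximum is only reached
   for n = 0, since distances are nonnegative. *)
Definition uniformly_disconnected (R : realType) (X : metricType R) : Prop :=
  exists c : R, 0 < c /\
    forall (n : nat) (x : nat -> X),
      c * mdist (x 0%N) (x n)
        <= \big[Num.max/0]_(1 <= k < n.+1) mdist (x k) (x k.-1).

Definition finite_subset_space (T : Type) (n : nat) : set (set T) :=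
  [set A | A !=set0 /\ A #<= `I_n].

Definition point_set_dist (R : realType) (X : metricType R)
    (a : X) (B : set X) : R :=
  inf [set mdist a b | b in B].

(* The suprema and infima are real-valued (0 by convention when they do not
   exist); they are genuine for nonempty finite sets, the only ones used. *)
Definition hausdorff_dist (R : realType) (X : metricType R)
    (A B : set X) : R :=
  Num.max (sup [set point_set_dist a B | a in A])
          (sup [set point_set_dist b A | b in B]).

(* A map X(n) -> X(m) is represented by a function on all subsets of X, of
   which only the values on X(n) are constrained. *)
Definition retraction (X : Type) (n m : nat) (f : set X -> set X) : Prop :=
  set_fun (finite_subset_space n) (finite_subset_space m) f /\
  (forall A, finite_subset_space m A -> f A = A).

Definition hausdorff_lipschitz (R : realType) (X : metricType R)
    (n : nat) (L : R) (f : set X -> set X) : Prop :=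
  forall A B, finite_subset_space n A -> finite_subset_space n B ->
    hausdorff_dist (f A) (f B) <= L * hausdorff_dist A B.

(* Main.v *)
Require Import Defs.
From HB Require Import structures.
From mathcomp Require Import all_boot all_order all_algebra.
From mathcomp Require Import all_classical all_reals all_analysis.
Set Implicit Arguments.
Unset Strict Implicit.
Unset Printing Implicit Defensive.
Import Order.TTheory GRing.Theory Num.Theory.
Local Open Scope classical_set_scope.
Local Open Scope ring_scope.

(** Let [rho x y] be the infimum of the [s] such that some chain with steps of
    length at most [s] joins [x] to [y]. It is an ultrametric and uniform
    disconnectedness says [c * d <= rho <= d]. Fix a representative in each
    closed [rho]-ball. For a finite set [A] let [scale m A] be the least [r] such
    that [A] meets at most [m] closed balls of radius [r], and let the retraction
    send [A] to the representatives of these balls. If the Hausdorff distance [t]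
    from [A] to [B] is at least both scales, then each point moves by at most
    [t]. Otherwise, since [A] and [B] meet the same balls of any radius at least
    [t], the two scales agree and [A] and [B] have the same image. *)

(** This lets one radius, just above a given value or very large, satisfy the conditions attached to
    all points of a finite set at once. *)
Lemma near_finite_set (I : choiceType) (T : Type) (F : set_system T)
    (FF : Filter F) (D : set I) (P : I -> T -> Prop) :
  finite_set D -> (forall i, D i -> \forall x \near F, P i x) ->
  \forall x \near F, forall i, D i -> P i x.
Proof.
move=> /finite_fsetP[s ->] DP.
by apply: filterS (filter_bigI (f := P) FF DP) => x Px i si; exact: Px.
Qed.

Lemma card_set1_le (T : Type) (x : T) (m : nat) :
  (0 < m)%N -> ([set x] #<= `I_m)%card.
Proof.
move=> m0; apply: (@card_le_trans _ _ _ `I_1).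
  by have := @card_set1 T x; rewrite card_eq_le => /andP[].
by apply: subset_card_le => i /= i1; exact: leq_trans i1 m0.
Qed.

(** * Hausdorff distance between finite sets *)

Section hausdorff.
Context {R : realType} {X : metricType R}.
Implicit Types (A B : set X) (a b : X) (r : R).

Lemma hausdorff_distC A B : hausdorff_dist A B = hausdorff_dist B A.
Proof. exact: maxC. Qed.

Let lbound_mdist a B : has_lbound [set mdist a b | b in B].
Proof. by exists 0 => _ [b _ <-]; exact: mdist_ge0. Qed.

Lemma point_set_dist_attained a B : finite_set B -> B !=set0 ->
  exists2 b, B b & mdist a b <= point_set_dist a B.
Proof.
move=> finB [b0 Bb0]; set r := point_set_dist a B.
(* Finitely many distances leave a gap above [r]: for [s] in this gap, a point closer than [s] is
   already within [r]. *)
have near_r : \forall s \near r^'+,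
    forall b, B b -> mdist a b < s -> mdist a b <= r.
  apply: near_finite_set finB _ => b Bb.
  have [le_r|lt_r] := leP (mdist a b) r; first exact: nearW.
  near=> s => lt_s.
  have : s < mdist a b by near: s; exact: nbhs_right_lt.
  by move=> /(lt_trans lt_s); rewrite ltxx.
near r^'+ => s.
have [||_ [b Bb <-] lt_s] := @inf_lt _ [set mdist a b | b in B] s.
- by exists (mdist a b0), b0.
- by near: s; exact: nbhs_right_gt.
by exists b => //; move: b Bb lt_s; near: s.
Unshelve. all: by end_near. Qed.

Lemma hausdorff_dist_nbhs A B a : finite_set A -> finite_set B ->
  B !=set0 -> A a -> exists2 b, B b & mdist a b <= hausdorff_dist A B.
Proof.
move=> finA finB B0 Aa.
have [b Bb ab] := point_set_dist_attained a finB B0; exists b => //.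
apply: le_trans ab _; rewrite le_max; apply/orP; left.
apply: ub_le_sup; last by exists a.
(* The supremum is genuine because finitely many values have a common bound [M]. *)
near (pinfty_nbhs R) => M; exists M => _ [x Ax <-].
move: x Ax; near: M; apply: near_finite_set finA _ => x _.
exact: nbhs_pinfty_ge (num_real _).
Unshelve. all: by end_near. Qed.

Lemma hausdorff_dist_le A B r : A !=set0 -> B !=set0 ->
  (forall a, A a -> exists2 b, B b & mdist a b <= r) ->
  (forall b, B b -> exists2 a, A a & mdist b a <= r) ->
  hausdorff_dist A B <= r.
Proof.
have half A' B' : A' !=set0 ->
    (forall a, A' a -> exists2 b, B' b & mdist a b <= r) ->
    sup [set point_set_dist a B' | a in A'] <= r.
  move=> [a0 Aa0] AB; apply: ge_sup; first by exists (point_set_dist a0 B'), a0.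
  move=> _ [a Aa <-]; have [b Bb] := AB a Aa; apply: le_trans.
  by apply: ge_inf => //; exists b.
by move=> A0 B0 AB BA; rewrite ge_max !half.
Qed.

Lemma hausdorff_dist_ge0 A B : finite_set A -> finite_set B ->
  A !=set0 -> B !=set0 -> 0 <= hausdorff_dist A B.
Proof.
move=> finA finB [a Aa] B0.
have [b _] := hausdorff_dist_nbhs finA finB B0 Aa.
exact/le_trans/mdist_ge0.
Qed.

Lemma hausdorff_distxx_le0 A : A !=set0 -> hausdorff_dist A A <= 0.
Proof.
by move=> A0; apply: hausdorff_dist_le => // a Aa; exists a; rewrite ?mdistxx.
Qed.

End hausdorff.

(** * Chains and the balls of the chain ultrametric *)

Section chains.
Context {R : realType} {X : metricType R}.
Implicit Types (x y z : X) (r s : R).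

Definition chain s x y : Prop :=
  exists p, path (fun u v : X => mdist u v <= s) x p /\ last x p = y.

(* [linked r x y] means [rho x y <= r] for the chain ultrametric [rho]. *)
Definition linked r x y : Prop := forall s, r < s -> chain s x y.

Lemma linked_mdist r x y : mdist x y <= r -> linked r x y.
Proof.
by move=> xy s rs; exists [:: y]; rewrite /= andbT (le_trans xy (ltW rs)).
Qed.

Lemma linked_sym r x y : linked r x y -> linked r y x.
Proof.
move=> xy s /xy[p [xp <-]]; exists (rev (belast x p)); split.
  by rewrite rev_path; under eq_path do rewrite metric_sym.
by case: p {xp} => //= z p; rewrite rev_cons last_rcons.
Qed.

Lemma linked_trans r y x z : linked r x y -> linked r y z -> linked r x z.
Proof.
move=> xy yz s rs; have [[p [xp <-]] [q [yq <-]]] := (xy s rs, yz s rs).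
by move: yq; exists (p ++ q); rewrite cat_path last_cat xp.
Qed.

Lemma linked_le r s x y : r <= s -> linked r x y -> linked s x y.
Proof. by move=> rs xy u su; apply: xy; exact: le_lt_trans su. Qed.

(** If [x] and [y] are not linked at [r], some [u > r] admits no chain, and then they are not linked
    at any [s] between [r] and [u]. *)
Lemma near_linked r x y : \forall s \near r^'+, linked s x y -> linked r x y.
Proof.
have [xy|/existsNP[u /not_implyP[ru xyu]]] := pselect (linked r x y).
  exact: nearW.
near=> s => /(_ u) xy; exfalso; apply/xyu/xy.
by near: s; exact: nbhs_right_lt.
Unshelve. all: by end_near. Qed.

Definition ball_rep r x : X := xget x (linked r x).

Lemma linked_refl r x : 0 <= r -> linked r x x.
Proof. by move=> r0; apply: linked_mdist; rewrite mdistxx. Qed.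

Lemma linked_rep r x : 0 <= r -> linked r x (ball_rep r x).
Proof. by move=> r0; apply: (@xgetI _ _ _ x); exact: linked_refl. Qed.

Lemma ball_rep_eq r x y : linked r x y -> ball_rep r x = ball_rep r y.
Proof.
move=> xy; have -> : ball_rep r x = xget x (linked r y).
  congr xget; apply/funext => z; apply/propext; split.
    exact/linked_trans/linked_sym.
  exact: linked_trans.
(* The defaults [x] and [y] differ, but the common ball contains [x], so neither is reached. *)
rewrite /ball_rep /xget; case: pselect => // -[]; exists x.
exact/asboolP/linked_sym.
Qed.

Lemma ball_repK r s x : 0 <= r -> r <= s ->
  ball_rep s (ball_rep r x) = ball_rep s x.
Proof.
move=> r0 rs; apply/esym/ball_rep_eq/(linked_le rs); exact: linked_rep.
Qed.

Lemma linked_of_ball_rep_eq r x y :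
  0 <= r -> ball_rep r x = ball_rep r y -> linked r x y.
Proof.
move=> r0 exy; apply: linked_trans (linked_rep x r0) _.
by rewrite exy; exact/linked_sym/linked_rep.
Qed.

End chains.

(** * The scale of a finite set *)

Section scale.
Context {R : realType} {X : metricType R}.
Implicit Types (A B : set X) (r s : R) (m : nat).

Definition covering_radius m A : set R :=
  [set r | 0 <= r /\ (ball_rep r @` A #<= `I_m)%card].

Definition scale m A : R := inf (covering_radius m A).

(** Balls of radius [r] lie inside balls of radius [s], so enlarging the radius can only merge
    them. *)
Lemma covering_radius_le m A r s :
  r <= s -> covering_radius m A r -> covering_radius m A s.
Proof.
move=> rs [r0 Ar]; split; first exact: le_trans rs.
suff -> : ball_rep s @` A = ball_rep s @` (ball_rep r @` A).
  exact: card_le_trans (card_image_le _ _) Ar.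
rewrite image_comp; apply: eq_imagel => x _ /=; exact/esym/ball_repK.
Qed.

Lemma covering_radius_nonempty m A : (0 < m)%N -> finite_set A ->
  covering_radius m A !=set0.
Proof.
move=> m0 finA; have [->|/set0P[a Aa]] := eqVneq A set0.
  by exists 0; split=> //; rewrite image_set0 card_ge0.
(* Once [M] exceeds all distances from [a], the whole of [A] lies in one ball. *)
near (pinfty_nbhs R) => M; exists M; split.
  by near: M; exact: nbhs_pinfty_ge (num_real _).
apply: card_le_trans (card_set1_le (ball_rep M a) m0).
apply: subset_card_le => _ [x Ax <-] /=; apply: ball_rep_eq.
apply: linked_mdist; move: x Ax; near: M; apply: near_finite_set finA _ => x _.
exact: nbhs_pinfty_ge (num_real _).
Unshelve. all: by end_near. Qed.

Lemma has_lbound_covering_radius m A : has_lbound (covering_radius m A).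
Proof. by exists 0 => r []. Qed.

Lemma scale_le m A r : covering_radius m A r -> scale m A <= r.
Proof. exact/ge_inf/has_lbound_covering_radius. Qed.

(** The infimum is attained: on the finitely many pairs of points of [A], being linked does not
    change for radii just above the scale, so no two balls merge there. *)
Lemma covering_radius_scale m A : (0 < m)%N -> finite_set A ->
  covering_radius m A (scale m A).
Proof.
move=> m0 finA; have covA := covering_radius_nonempty m0 finA.
have scale0 : 0 <= scale m A by apply: lb_le_inf => // r [].
split=> //; set r := scale m A.
have near_r : \forall s \near r^'+, forall ab, (A `*` A) ab ->
    linked s ab.1 ab.2 -> linked r ab.1 ab.2.
  apply: near_finite_set; first exact: finite_setX.
  by move=> ab _; exact: near_linked.
near r^'+ => u.
have [|s cov_s su] := @inf_lt _ (covering_radius m A) u covA.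
  by near: u; exact: nbhs_right_gt.
have rs : r <= s by exact: scale_le.
have s_r a b : A a -> A b -> linked s a b -> linked r a b.
  move=> Aa Ab /(linked_le (ltW su)).
  have : forall ab, (A `*` A) ab -> linked u ab.1 ab.2 -> linked r ab.1 ab.2.
    by near: u.
  by move=> /(_ (a, b)); exact.
(* Balls of radius [r] meeting [A] stay distinct at radius [s], so both radii give the same
   count. *)
have inj : set_inj (ball_rep r @` A) (ball_rep s).
  move=> _ _ /set_mem[a Aa <-] /set_mem[b Ab <-]; rewrite !ball_repK// => eab.
  apply/ball_rep_eq/s_r => //; exact: linked_of_ball_rep_eq (le_trans scale0 rs) eab.
have := inj_card_eq inj; rewrite card_eq_sym => /card_le_eql ->.
rewrite image_comp (eq_imagel (f' := ball_rep s)); first by case: cov_s.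
by move=> x _ /=; exact: ball_repK.
Unshelve. all: by end_near. Qed.

Lemma scale_small m A : (A #<= `I_m)%card -> (0 < m)%N -> scale m A = 0.
Proof.
move=> Am m0; have finA : finite_set A by apply/finite_set_leP; exists m.
have [scale0 _] := covering_radius_scale m0 finA.
apply/eqP; rewrite eq_le scale0 andbT; apply: scale_le; split=> //.
exact: card_le_trans (card_image_le _ _) Am.
Qed.

(** Each point of one set has a point of the other within [s], hence in the same ball. *)
Lemma ball_rep_image_hausdorff A B s : finite_set A -> finite_set B ->
  A !=set0 -> B !=set0 -> hausdorff_dist A B <= s ->
  ball_rep s @` A = ball_rep s @` B.
Proof.
have half A' B' : finite_set A' -> finite_set B' -> B' !=set0 ->
    hausdorff_dist A' B' <= s -> ball_rep s @` A' `<=` ball_rep s @` B'.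
  move=> finA finB B0 ABs _ [a Aa <-].
  have [b Bb ab] := hausdorff_dist_nbhs finA finB B0 Aa.
  exists b => //; apply/esym/ball_rep_eq/linked_mdist; exact: le_trans ABs.
move=> finA finB A0 B0 ABs; apply/seteqP; split; first exact: half.
by apply: half => //; rewrite hausdorff_distC.
Qed.

Lemma scale_hausdorff m A B : (0 < m)%N -> finite_set A -> finite_set B ->
  A !=set0 -> B !=set0 ->
  scale m B <= Num.max (hausdorff_dist A B) (scale m A).
Proof.
move=> m0 finA finB A0 B0; set s := Num.max _ _.
have [] := @covering_radius_le m A (scale m A) s.
- by rewrite le_max lexx orbT.
- exact: covering_radius_scale.
move=> s0 As; apply: scale_le; split=> //.
by rewrite -(ball_rep_image_hausdorff finA finB)// le_max lexx.
Qed.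

Definition ball_retraction m A : set X := ball_rep (scale m A) @` A.

End scale.

(** * The Lipschitz retraction under uniform disconnectedness *)

Section uniformly_disconnected.
Context {R : realType} {X : metricType R} (c : R).
Hypothesis c0 : 0 < c.
Hypothesis c_chain : forall (n : nat) (x : nat -> X),
  c * mdist (x 0%N) (x n)
    <= \big[Num.max/0]_(1 <= k < n.+1) mdist (x k) (x k.-1).
Implicit Types (A B : set X) (x y : X) (r : R) (m n : nat).

Lemma mdist_linked r x y : 0 <= r -> linked r x y -> mdist x y <= c^-1 * r.
Proof.
move=> r0 xy; rewrite mulrC ler_pdivlMr// mulrC.
apply/ler_addgt0Pr => e e0.
have [|p [/(pathP x) xp <-]] := xy (r + e); first by rewrite ltrDl.
have := c_chain (size p) (nth x (x :: p)).
rewrite -last_nth => /le_trans; apply.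
rewrite big_nat_cond; apply: (big_ind (fun u => u <= r + e)).
(* The default 0 of the maximum, which is its value for the empty chain, is where [0 <= r] is
   used. *)
- by rewrite addr_ge0// ltW.
- by move=> u v ur vr; rewrite ge_max ur.
case=> [//|k] /andP[/= kp _]; rewrite metric_sym; exact: xp.
Qed.

Lemma linked0_eq x y : linked 0 x y -> x = y.
Proof.
move=> /(mdist_linked (lexx 0)); rewrite mulr0 => xy.
by apply/mdist_positivity/eqP; rewrite eq_le xy mdist_ge0.
Qed.

Lemma retraction_ball_retraction n m : (0 < m)%N ->
  retraction n m (@ball_retraction R X m).
Proof.
move=> m0; split=> [A [[a Aa] An]|A [_ Am]].
  have finA : finite_set A by apply/finite_set_leP; exists n.
  split; first by exists (ball_rep (scale m A) a), a.
  by have [] := covering_radius_scale m0 finA.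
(* At scale 0 the balls are singletons, so every point represents itself. *)
rewrite /ball_retraction scale_small//.
rewrite (eq_imagel (f' := id)) ?image_id// => x _.
exact/esym/linked0_eq/linked_rep.
Qed.

Lemma lipschitz_ball_retraction n m (L : R) : (0 < m)%N -> c^-1 <= L ->
  hausdorff_lipschitz n L (@ball_retraction R X m).
Proof.
move=> m0 cL A B [A0 An] [B0 Bn].
have finA : finite_set A by apply/finite_set_leP; exists n.
have finB : finite_set B by apply/finite_set_leP; exists n.
have nz (D : set X) : D !=set0 -> ball_retraction m D !=set0.
  by move=> [x Dx]; exists (ball_rep (scale m D) x), x.
set t := hausdorff_dist A B.
have t0 : 0 <= t by exact: hausdorff_dist_ge0.
have AB : scale m B <= Num.max t (scale m A) by exact: scale_hausdorff.
have BA : scale m A <= Num.max t (scale m B).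
  by rewrite /t hausdorff_distC; exact: scale_hausdorff.
have L0 : 0 <= L by apply: le_trans cL; rewrite invr_ge0 ltW.
have [At|tA] := leP (scale m A) t; last first.
  (* As [scale m A] exceeds [t], the two bounds on the scales force equality; at this common radius
     [A] and [B] meet the same balls. *)
  move: AB; rewrite (max_r (ltW tA)) => leBA.
  move: BA; rewrite le_max leNgt tA/= => leAB.
  have eAB : scale m A = scale m B by apply/eqP; rewrite eq_le leAB.
  rewrite /ball_retraction -eAB.
  rewrite (ball_rep_image_hausdorff finA finB) ?(ltW tA)//.
  apply: le_trans (hausdorff_distxx_le0 _) (mulr_ge0 L0 t0).
  by rewrite eAB; exact: nz.
have Bt : scale m B <= t by rewrite (le_trans AB)// ge_max lexx.
have half A' B' : finite_set A' -> finite_set B' -> B' !=set0 ->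
    scale m A' <= t -> scale m B' <= t -> hausdorff_dist A' B' = t ->
    forall a, ball_retraction m A' a ->
    exists2 b, ball_retraction m B' b & mdist a b <= L * t.
  move=> finA' finB' B'0 At' Bt' ABt _ [a Aa <-].
  have [b Bb ab] := hausdorff_dist_nbhs finA' finB' B'0 Aa.
  have moved (D : set X) x : finite_set D -> scale m D <= t ->
      linked t x (ball_rep (scale m D) x).
    move=> finD Dt; apply/(linked_le Dt)/linked_rep.
    by have [] := covering_radius_scale m0 finD.
  exists (ball_rep (scale m B') b); first by exists b.
  (* Three links at radius [t], namely representative to point, point to nearby point and point to
     representative, compose to one link at radius [t]. By the ultrametric inequality no factor 3
     appears. *)
  apply: le_trans (ler_wpM2r t0 cL); apply: mdist_linked => //.
  apply: linked_trans (linked_sym (moved _ _ finA' At')) _.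
  apply: linked_trans (moved _ _ finB' Bt').
  by apply: linked_mdist; rewrite -ABt.
apply: hausdorff_dist_le; [exact: nz|exact: nz|exact: half|].
by apply: half => //; rewrite hausdorff_distC.
Qed.

End uniformly_disconnected.

Theorem corollary3p3 (R : realType) (X : metricType R)
    (hX : uniformly_disconnected X) :
  exists L : R, 1 <= L /\
    forall n m : nat, (1 <= m)%N -> (m < n)%N ->
      exists f : set X -> set X,
        retraction n m f /\ hausdorff_lipschitz n L f.
Proof.
have [c [c0 c_chain]] := hX.
(* The Lipschitz bound comes from [c^-1]; the maximum with 1 only ensures [1 <= L]. *)
exists (Num.max 1 c^-1); split; first by rewrite le_max lexx.
move=> n m m0 _; exists (@ball_retraction R X m); split.
  exact: retraction_ball_retraction c_chain _ _ m0.
by apply: (lipschitz_ball_retraction c0 c_chain) => //; rewrite le_max lexx orbT.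
Qed.
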